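(* Let $k \geq 3$ and $0 < \varepsilon \leq \frac{k-1}{2}$ be integers. Then for every positive integer $n$ there does not exist a $\mathrm{vgr}\left(n,k,5,\frac{k(k-1)^2}{2}-\varepsilon\right)$-graph; that is, there is no $k$-regular graph of girth $5$ on $n$ vertices in which every vertex is contained in exactly $\frac{k(k-1)^2}{2}-\varepsilon$ cycles of length $5$.
   Context: Graphs are finite, simple and undirected. The girth of a graph is the length of its shortest cycle. Cycles are counted as subgraphs (i.e. without a choice of starting vertex or orientation). For integers $n,k,g,\lambda$, a $\mathrm{vgr}(n,k,g,\lambda)$-graph (vertex-girth-regular graph) is a $k$-regular graph of girth $g$ on $n$ vertices such that each vertex is contained in exactly $\lambda$ cycles of length $g$. *)

(* Defs.v *)
From mathcomp Require Import all_boot.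
Set Implicit Arguments.
Unset Strict Implicit.
Unset Printing Implicit Defensive.

Record sgraph (T : finType) := SGraph {
  adj :> rel T;
  adj_sym : symmetric adj;
  adj_irr : irreflexive adj
}.

Section VertexGirthRegular.

Variable T : finType.
Implicit Types (G : sgraph T) (c : seq T) (C : {set {set T}}).

Definition cycle_edges c : {set {set T}} := [set [set x; next c x] | x in c].

(* A cycle, as a subgraph without isolated vertices, is determined by its edge
   set; the 2 * m vertex sequences that traverse the same m-cycle yield a single
   element here.  The condition 2 < m excludes the degenerate closed walks that
   ucycle accepts (the empty sequence, and an edge traversed back and forth). *)
Definition cycles G (m : nat) : {set {set {set T}}} :=
  [set cycle_edges c | c : m.-tuple T & (2 < m) && ucycleb G c].

Definition cycles_at G (m : nat) (x : T) : {set {set {set T}}} :=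
  [set C in cycles G m | x \in cover C].

Definition has_girth G (g : nat) : Prop :=
  cycles G g != set0 /\ forall m, cycles G m != set0 -> g <= m.

Definition regular G (k : nat) : Prop :=
  forall x, #|[set y | adj G x y]| = k.

Definition vgr G (n k g lambda : nat) : Prop :=
  [/\ #|T| = n, regular G k, has_girth G g
    & forall x, #|cycles_at G g x| = lambda].

End VertexGirthRegular.

(* Main.v *)
Require Import Defs.
From mathcomp Require Import all_boot.
From mathcomp Require Import zify.

(** Call a path x, a, b, c escaping when c is at distance 3 from x.  In a
    k-regular graph of girth 5 there are k (k - 1)^2 paths of length 3 from x,
    and such a path is non-escaping exactly when it closes up to a 5-cycle, in a
    unique way; each 5-cycle through x arises twice, once per direction.  Hence
    a vertex on k (k - 1)^2 / 2 - eps pentagons has 2 eps escaping paths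
    (card_escaping), and the hypotheses say that this number is positive and
    smaller than k, at every vertex.  These two facts are incompatible
    (escaping_empty), for the following reason.

    As there are fewer than k escaping paths from c, some neighbour c' of c
    is the second vertex of none of them.  This means that the ball of radius 2 around c' lies in
    the one around c; in a regular graph of girth 5 both have k^2 + 1 elements,
    so they coincide (exists_nbr_ball2).

    Now let x, a, c, d be an escaping path, and let S be the ball of radius 2
    around x.  The edges that leave S are last edges of escaping paths from x,
    so there are fewer than k of them.  With c' as above, c' is in S because x is
    in the ball around c, whereas d is outside S.  But there are k edge-disjoint
    walks from d to c': every neighbour e of d is within distance 2 of c, hence
    of c', which gives a walk d, e, f, c', and for e = c the walk d, c, c'.
    Each of them crosses the boundary of S, which therefore contains at least k
    edges (degree_le_cut): a contradiction. *)

(** * Counting *)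

Lemma card_dep_pairs (S T : finType) (A : {set S}) (R : S -> pred T) (m : nat) :
    (forall a, a \in A -> #|[set y | R a y]| = m) ->
  #|[set p : S * T | (p.1 \in A) && R p.1 p.2]| = #|A| * m.
Proof.
move=> Rm; rewrite -sum1_card -sum_nat_const.
under eq_bigl => p do rewrite inE.
rewrite -(pair_big_dep (fun a => a \in A) R (fun _ _ => 1)) /=.
apply: eq_bigr => a /Rm <-; rewrite -sum1_card.
by apply: eq_bigl => y; rewrite inE.
Qed.

Lemma leq_card_surj (S T : finType) (f : S -> T) (A : {set S}) (B : {set T}) :
  (forall y, y \in B -> exists2 x, x \in A & y = f x) -> #|B| <= #|A|.
Proof.
move=> fAB; apply: leq_trans (leq_imset_card f A).
by apply/subset_leq_card/subsetP => y /fAB[x Ax ->]; apply: imset_f.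
Qed.

(** * Cycles through a given vertex *)

Section CycleEdges.

Variable T : finType.
Implicit Types (x y z : T) (p q s : seq T).

Lemma set2_inj x y u v :
  [set x; y] = [set u; v] -> (x = u /\ y = v) \/ (x = v /\ y = u).
Proof.
move=> E.
have := set21 x y; rewrite E !inE => /orP[]/eqP xE.
  left; split=> //; have := set22 x y; rewrite E !inE => /orP[]/eqP // yE.
  by have := set22 u v; rewrite -E xE yE !inE orbb => /eqP.
right; split=> //; have := set22 x y; rewrite E !inE => /orP[]/eqP // yE.
by have := set21 u v; rewrite -E xE yE !inE orbb => /eqP.
Qed.

(** The edge set thus determines next and prev up to exchange at each vertex;
    this is what makes it possible to recover the cycle from its edges. *)
Lemma mem_cycle_edges s y z : uniq s -> y \in s ->
  ([set y; z] \in cycle_edges s) = (z == next s y) || (z == prev s y).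
Proof.
move=> Us sy; apply/imsetP/orP => [[w sw /set2_inj[][-> ->]]|[]/eqP->].
- by left.
- by right; rewrite prev_next.
- by exists y.
by exists (prev s y); rewrite ?mem_prev // next_prev // setUC.
Qed.

Lemma cycle_edges_rot n s : uniq s -> cycle_edges (rot n s) = cycle_edges s.
Proof.
move=> Us; apply/setP => e; apply/imsetP/imsetP => -[w].
  by rewrite mem_rot next_rot // => sw ->; exists w.
by move=> sw ->; exists w; rewrite ?mem_rot ?next_rot.
Qed.

Lemma cycle_edges_rev s : uniq s -> cycle_edges (rev s) = cycle_edges s.
Proof.
have sub (r : seq T) : uniq r -> cycle_edges (rev r) \subset cycle_edges r.
  move=> Ur; apply/subsetP => e /imsetP[w]; rewrite mem_rev => rw ->.
  by rewrite next_rev // mem_cycle_edges // eqxx orbT.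
move=> Us; apply/eqP; rewrite eqEsubset sub //=.
by rewrite -{1}[s]revK sub // rev_uniq.
Qed.

Lemma cover_cycle_edges s x : (x \in cover (cycle_edges s)) = (x \in s).
Proof.
apply/bigcupP/idP => [[e /imsetP[w sw ->]]|sx].
  by rewrite !inE => /orP[]/eqP->; rewrite ?mem_next.
by exists [set x; next s x]; rewrite ?set21 //; apply: imset_f.
Qed.

Lemma cycle_edges_cons_rev x p : uniq (x :: p) ->
  cycle_edges (x :: rev p) = cycle_edges (x :: p).
Proof.
move=> Us; rewrite -(cycle_edges_rev _ Us) rev_cons -rot1_cons.
rewrite cycle_edges_rot //.
by rewrite /= mem_rev rev_uniq.
Qed.

Lemma next_next_neq s y : uniq s -> 2 < size s -> y \in s ->
  next s (next s y) != y.
Proof.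
move=> Us s_gt2 /rot_to[i r rE].
have : 2 < size (rot i s) by rewrite size_rot.
have : uniq (rot i s) by rewrite rot_uniq.
rewrite -!(next_rot i Us) rE; case: r {rE} => [|a [|b r]] //=.
rewrite eqxx !inE !negb_or => /andP[/and3P[ya yb _] _] _.
by rewrite [a == y]eq_sym (negPf ya) eqxx eq_sym.
Qed.

(** Once both cycles leave x in the same direction they cannot separate: at each
    vertex, the only other edge is the one just traversed, and turning back
    along it is excluded by next_next_neq. *)
Lemma eq_next_cycle_edges x p q :
    uniq (x :: p) -> uniq (x :: q) -> size q = size p -> 1 < size p ->
    cycle_edges (x :: q) = cycle_edges (x :: p) ->
  next (x :: q) x = next (x :: p) x -> q = p.
Proof.
set s := x :: p; set s' := x :: q => Us Us' qp p_gt1 E nx.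
have pE : p = traject (next s) (next s x) (size p).
  by apply: fpathE; have := cycle_next Us; rewrite /= rcons_path => /andP[].
have qE : q = traject (next s') (next s' x) (size q).
  by apply: fpathE; have := cycle_next Us'; rewrite /= rcons_path => /andP[].
suff step n : iter n (next s') x = iter n (next s) x /\
    iter n.+1 (next s') x = iter n.+1 (next s) x.
  rewrite pE qE qp nx; apply: (@eq_from_nth _ (next s x)) => [|i];
    rewrite !size_traject // => ip.
  by rewrite !nth_traject // -{1}nx -!iterSr; case: (step i).
have mem_s m : iter m (next s) x \in s.
  by elim: m => [|m]; rewrite ?mem_head ?iterS ?mem_next.
elim: n => [//|n [IHn IHn1]]; split=> //; rewrite iterS [RHS]iterS IHn1.
set y := iter n.+1 (next s) x in IHn1 *.
have s'y : y \in s'.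
  by rewrite -IHn1; elim: (n.+1) => [|m]; rewrite ?mem_head ?iterS ?mem_next.
have := mem_cycle_edges _ _ (next s' y) Us (mem_s n.+1).
rewrite -E mem_cycle_edges // eqxx => /esym/orP[]/eqP // yE.
have s'x0 : iter n (next s') x \in s' by rewrite -mem_next -iterS IHn1.
have : next s' (next s' (iter n (next s') x)) != iter n (next s') x.
  by apply: next_next_neq; rewrite //= qp.
by rewrite -iterS IHn1 yE /y iterS prev_next // IHn eqxx.
Qed.

Lemma cycle_edges_cons_inj x p q :
    uniq (x :: p) -> uniq (x :: q) -> size q = size p -> 1 < size p ->
  (cycle_edges (x :: q) == cycle_edges (x :: p)) = (q == p) || (q == rev p).
Proof.
move=> Up Uq qp p_gt1; apply/eqP/orP => [E|[]/eqP->];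
  rewrite ?cycle_edges_cons_rev //.
have := mem_cycle_edges _ _ (next (x :: q) x) Up (mem_head _ _).
rewrite -E mem_cycle_edges ?mem_head // eqxx => /esym/orP[]/eqP nx.
  by left; apply/eqP; apply: eq_next_cycle_edges nx.
have Ur : uniq (x :: rev p) by rewrite /= mem_rev rev_uniq.
right; apply/eqP; apply: (@eq_next_cycle_edges x) => //; rewrite ?size_rev //.
  by rewrite cycle_edges_cons_rev.
rewrite nx -(next_rev Up) rev_cons -(next_rot (size p)); last first.
  by rewrite -rev_cons rev_uniq.
by rewrite -[size p]size_rev -cats1 rot_size_cat.
Qed.

Lemma rev_neq p : uniq p -> 1 < size p -> rev p != p.
Proof.
case: p => [|a p] //= /andP[ap _] p_gt0.
apply: contraNneq ap => /(congr1 (head a)).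
case/lastP: p p_gt0 => // p b _; rewrite rev_cons rev_rcons /= => <-.
by rewrite mem_rcons mem_head.
Qed.

End CycleEdges.

Section Graph.

Variables (T : finType) (G : sgraph T).
Implicit Types (x y : T) (S : {set T}).

(** A cycle through x, as an edge set, is traversed from x in exactly two ways,
    which are mutually reverse; they differ because the cycle has length at
    least 3. *)
Lemma card_rooted_cycles m x : 1 < m ->
  #|[set p : m.-tuple T | ucycleb G (x :: p)]| = 2 * #|cycles_at G m.+1 x|.
Proof.
move=> m_gt1; set W := [set p | _].
pose F (p : m.-tuple T) := cycle_edges (x :: p).
rewrite -sum1_card (partition_big F (mem (cycles_at G m.+1 x))) /=; last first.
  move=> p; rewrite inE => Wp; rewrite inE cover_cycle_edges mem_head andbT.
  by apply/imsetP; exists [tuple of x :: p]; rewrite // inE ltnS m_gt1.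
rewrite mulnC -sum_nat_const; apply: eq_bigr => C; rewrite inE => /andP[].
case/imsetP => c; rewrite inE => /andP[_ /andP[Gc Uc]] ->.
rewrite cover_cycle_edges => /rot_to[i q rotE].
have sz_q : size q == m.
  by have := size_rot i c; rewrite rotE size_tuple => -[->].
pose p := Tuple sz_q.
have Wp : ucycleb G (x :: p) by rewrite /ucycleb -rotE rot_cycle Gc rot_uniq.
have [Gp Up] := andP Wp.
have -> : cycle_edges c = F p by rewrite /F /= -rotE cycle_edges_rot.
have <- : #|[set p; rev_tuple p]| = 2.
  rewrite cards2 eq_sym -val_eqE /= rev_neq ?(eqP sz_q) //.
  by case/andP: Up.
rewrite sum1dep_card; apply: eq_card => r; rewrite !inE.
have Wrev : ucycleb G (x :: rev p).
  rewrite /ucycleb; have -> : uniq (x :: rev p).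
    by rewrite /= mem_rev rev_uniq.
  rewrite andbT -(rot_cycle 1) rot1_cons -rev_cons rev_cycle.
  by apply: etrans Gp; apply: eq_cycle => u v /=; rewrite adj_sym.
have eqF : ucycleb G (x :: r) -> (F r == F p) = (r == p) || (r == rev_tuple p).
  by case/andP => _ Ur; rewrite /F cycle_edges_cons_inj ?size_tuple.
apply/andP/orP => [[Wr]|rp]; first by rewrite eqF // => /orP.
have Wr : ucycleb G (x :: r) by case: rp => /eqP->.
by rewrite eqF //; split=> //; apply/orP.
Qed.

(** * Girth 5 *)

Lemma girth_leq g (s : seq T) :
  has_girth G g -> 2 < size s -> ucycleb G s -> g <= size s.
Proof.
case=> _ g_min s_gt2 Gs; apply: g_min; apply/set0Pn; exists (cycle_edges s).
by apply/imsetP; exists (in_tuple s); rewrite // inE s_gt2.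
Qed.

Lemma girth5_triangle x y z : has_girth G 5 -> G x y -> G y z -> ~~ G x z.
Proof.
move=> g5 xy yz; apply/negP => xz.
have := @girth_leq 5 [:: x; y; z] g5 isT.
rewrite /ucycleb /= xy yz adj_sym xz !inE /=.
case: eqP => [E|_]; first by rewrite E adj_irr in xy.
case: eqP => [E|_]; first by rewrite E adj_irr in xz.
case: eqP => [E|_]; first by rewrite E adj_irr in yz.
by move=> /(_ isT).
Qed.

Lemma girth5_quad x y u v : has_girth G 5 -> x != y ->
  G x u -> G u y -> G x v -> G v y -> u = v.
Proof.
move=> g5 xy xu uy xv vy; apply/eqP; apply/negPn/negP => uv.
have := @girth_leq 5 [:: x; u; y; v] g5 isT.
rewrite /ucycleb /= xu uy adj_sym vy adj_sym xv !inE /= (negPf xy) (negPf uv).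
case: eqP => [E|_]; first by rewrite E adj_irr in xu.
case: eqP => [E|_]; first by rewrite E adj_irr in xv.
case: eqP => [E|_]; first by rewrite E adj_irr in uy.
case: eqP => [E|_]; first by rewrite E adj_irr in vy.
by move=> /(_ isT).
Qed.

(** * Balls of radius 2 and escaping paths *)

Definition nbhd x : {set T} := [set y | G x y].

Definition ball2 x : {set T} :=
  [set y | [|| y == x, G x y | [exists a, G x a && G a y]]].

(** A path x, a, b is encoded by the pair (a, b); in paths3 below, x, a, b, c is
    encoded by (a, b, c). *)
Definition paths2 x : {set T * T} :=
  [set p | (p.1 \in nbhd x) && (G p.1 p.2 && (p.2 != x))].

Definition paths3 x : {set T * T * T} :=
  [set p | (p.1 \in paths2 x) && (G p.1.2 p.2 && (p.2 != p.1.1))].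

Definition escaping x : {set T * T * T} :=
  [set p in paths3 x | p.2 \notin ball2 x].

Definition cut S : {set T * T} :=
  [set e | [&& G e.1 e.2, e.1 \in S & e.2 \notin S]].

Lemma ball2_adj x y : G x y -> y \in ball2 x.
Proof. by rewrite inE => ->; rewrite orbT. Qed.

Lemma ball2_path x a y : G x a -> G a y -> y \in ball2 x.
Proof.
by move=> xa ay; rewrite inE; apply/or3P/Or33/existsP; exists a; rewrite xa.
Qed.

Lemma ball2_sym x y : (x \in ball2 y) = (y \in ball2 x).
Proof.
rewrite !inE eq_sym adj_sym; congr [|| _, _ | _].
by apply: eq_existsb => a; rewrite andbC ![G a _]adj_sym.
Qed.

(** An edge (u, v) that leaves the ball starts at distance 2 from x, so a path
    x, a, u followed by this edge is escaping. *)
Lemma card_cut_ball2 x : #|cut (ball2 x)| <= #|escaping x|.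
Proof.
apply: (@leq_card_surj _ _ (fun p => (p.1.2, p.2))) => -[u v]; rewrite inE /=.
case/and3P => uv; rewrite [in X in X -> _]inE.
case/or3P => [/eqP ux|xu|/existsP[a /andP[xa au]]] vNB.
- by rewrite ball2_adj -?ux in vNB.
- by rewrite (ball2_path _ u) in vNB.
exists ((a, u), v) => //; rewrite inE vNB andbT !inE /= xa au uv /=.
apply/andP; split; last by apply: contraNneq vNB => ->; apply: ball2_adj.
apply: contraNneq vNB => ux; by apply: ball2_adj; rewrite -ux.
Qed.

Section Girth5.

Hypothesis girth5 : has_girth G 5.

Variable k : nat.
Hypothesis regG : regular G k.

Lemma card_nbhdD1 x y : G x y -> #|[set z | G x z && (z != y)]| = k - 1.
Proof.
move=> xy; rewrite -(regG x) (cardsD1 y [set z | G x z]) inE xy add1n subn1 /=.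
by apply: eq_card => z; rewrite !inE andbC.
Qed.

Lemma card_paths2 x : #|paths2 x| = k * (k - 1).
Proof.
rewrite -{1}(regG x).
apply: (@card_dep_pairs _ _ (nbhd x) (fun a b => G a b && (b != x))) => a.
by rewrite inE adj_sym => /card_nbhdD1.
Qed.

Lemma card_paths3 x : #|paths3 x| = k * (k - 1) ^ 2.
Proof.
rewrite expnS expn1 mulnA -(card_paths2 x).
apply: (@card_dep_pairs _ _ (paths2 x) (fun p c => G p.2 c && (c != p.1))).
move=> -[a b].
by rewrite !inE /= => /and3P[_ ab _]; apply: card_nbhdD1; rewrite adj_sym.
Qed.

Lemma card_ball2 x : #|ball2 x| = (k * (k - 1) + k).+1.
Proof.
have -> : ball2 x = x |: ([set p.2 | p in paths2 x] :|: nbhd x).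
  apply/setP => y; rewrite !inE.
  have [//|yx] := eqVneq y x; rewrite /= orbC; congr (_ || _).
  apply/existsP/imsetP => [[a /andP[xa ay]]|[[a b]]].
    by exists (a, y); rewrite // !inE /= xa ay.
  by rewrite !inE /= => /and3P[xa ab _] ->; exists a; rewrite xa.
have /card_in_imset snd_inj : {in paths2 x &, injective snd}.
  move=> [a b] [a' b']; rewrite !inE /= => /and3P[xa ab bx] /and3P[xa' ab' _] E.
  by subst b'; rewrite (girth5_quad x b a a') // eq_sym.
have /disjoint_setI0 disj : [disjoint [set p.2 | p in paths2 x] & nbhd x].
  apply/pred0P => y /=; apply/andP => -[/imsetP[[a b]]].
  rewrite !inE /= => /and3P[xa ab _] -> xb.
  by case/negP: (girth5_triangle _ _ _ girth5 xa ab).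
have nbx : #|nbhd x| = k := regG x.
rewrite cardsU1 cardsU disj cards0 subn0 snd_inj card_paths2 nbx.
suff -> : x \notin [set p.2 | p in paths2 x] :|: nbhd x by [].
rewrite !inE adj_irr orbF; apply/imsetP => -[[a b]].
by rewrite !inE /= => /and3P[_ _ bx] xb; rewrite xb eqxx in bx.
Qed.

(** The end c of a 3-path from x is at distance at least 2 from x, so if it is
    in the ball then it has a common neighbour d with x.  This d is unique, as
    there are no 4-cycles, and it closes the path to a pentagon. *)
Lemma card_pentagons x :
  #|[set p : 4.-tuple T | ucycleb G (x :: p)]|
    = #|[set p in paths3 x | p.2 \in ball2 x]|.
Proof.
set W := [set p : 4.-tuple T | _].
pose f (p : 4.-tuple T) :=
  (tnth p (inord 0), tnth p (inord 1), tnth p (inord 2)).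
have fE a b c d (p : 4.-tuple T) : tval p = [:: a; b; c; d] -> f p = (a, b, c).
  by move=> pE; rewrite /f !(tnth_nth a) !inordK // pE.
have WP (p : 4.-tuple T) : p \in W -> exists a b c d,
    tval p = [:: a; b; c; d] /\ [/\ G x a, G a b, G b c & G c d]
    /\ [/\ G d x, b != x, c != a & c != x].
  case: p => [[|a[|b[|c[|d[|]]]]] i] //; rewrite inE /ucycleb /= !inE !negb_or.
  case/andP => /and5P[xa ab bc cd /andP[dx _]].
  case/andP => /and4P[_ xb xc _] /andP[/and3P[_ ac _] _].
  by exists a, b, c, d; do !split=> //; rewrite eq_sym.
have f_inj : {in W &, injective f}.
  move=> p q /WP[a [b [c [d [pE [[_ _ _ cd] [dx _ _ cx]]]]]]].
  move=> /WP[a' [b' [c' [d' [qE [[_ _ _ cd'] [dx' _ _ _]]]]]]].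
  rewrite (fE _ _ _ _ _ pE) (fE _ _ _ _ _ qE) => -[aE bE cE].
  apply: val_inj; rewrite /= pE qE aE bE cE; congr [:: _; _; _; _].
  by rewrite -cE in cd'; apply: (girth5_quad c x).
rewrite -(card_in_imset f_inj); apply: eq_card => -[[a b] c]; apply/imsetP/idP.
  case=> p /WP[a' [b' [c' [d [pE [[xa ab bc cd] [dx bx ca cx]]]]]]].
  rewrite (fE _ _ _ _ _ pE) => -[-> -> ->]; rewrite !inE /= xa ab bx bc ca /=.
  apply/or3P/Or33/existsP; exists d.
  by rewrite [G x d]adj_sym dx adj_sym.
rewrite inE /= => /andP[]; rewrite [in X in X -> _]inE /= => /andP[].
rewrite !inE /=.
case/and3P=> xa ab bx /andP[bc ca] /or3P[/eqP cx|xc|].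
- by case/negP: (girth5_triangle _ _ _ girth5 xa ab); rewrite adj_sym -cx.
- by case/eqP: ca; apply: (girth5_quad b x) => //; rewrite adj_sym.
case/existsP => d /andP[xd dc].
have neq u v : G u v -> (u == v) = false.
  by move=> uv; apply/eqP => E; rewrite E adj_irr in uv.
have acF := girth5_triangle _ _ _ girth5 ab bc.
have xbF := girth5_triangle _ _ _ girth5 xa ab.
have xc : x != c by apply: contraNneq xbF => ->; rewrite adj_sym.
have ad : a != d by apply: contraNneq acF => ->.
have bd : b != d by apply: contraNneq xbF => ->.
have Wp : [tuple a; b; c; d] \in W.
  rewrite inE /ucycleb /= !inE xa ab bc [G c d]adj_sym dc.
  rewrite [G d x]adj_sym xd.
  rewrite (neq x a) // (neq x d) // (neq a b) // (neq b c) //.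
  rewrite (neq c d) ?[G c d]adj_sym //.
  by rewrite [x == b]eq_sym [a == c]eq_sym !negb_or bx ca xc ad bd.
by exists [tuple a; b; c; d] => //; rewrite (fE a b c d).
Qed.

Lemma card_escaping x :
  #|escaping x| + 2 * #|cycles_at G 5 x| = k * (k - 1) ^ 2.
Proof.
rewrite -(card_paths3 x) -(@card_rooted_cycles 4 x) // card_pentagons addnC.
rewrite -(cardsID [set p | p.2 \in ball2 x] (paths3 x)).
by congr (_ + _); apply: eq_card => p; rewrite !inE // andbC.
Qed.

(** The pigeonhole principle provides a neighbour c' of c through which no
    path escapes from c, so that the ball around c' lies in the one around c;
    that balls have equal cardinals turns this inclusion into an equality. *)
Lemma exists_nbr_ball2 c : #|escaping c| < k ->
  exists2 c', G c c' & ball2 c = ball2 c'.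
Proof.
move=> esc_lt.
have [c' /andP[cc' c'N]] :
    exists c', G c c' && (c' \notin [set p.1.1 | p in escaping c]).
  apply/existsP; apply: contraLR esc_lt.
  rewrite -leqNgt -(regG c) => /existsPn noc.
  apply: leq_trans (leq_imset_card (fun p => p.1.1) _).
  apply/subset_leq_card/subsetP => y; rewrite inE => cy.
  by have := noc y; rewrite cy negbK.
exists c' => //; apply/esym/eqP; rewrite eqEcard !card_ball2 leqnn andbT.
apply/subsetP => y; rewrite [in X in X -> _]inE.
case/or3P => [/eqP->|c'y|/existsP[b /andP[c'b bye]]]; first exact: ball2_adj.
  exact: ball2_path cc' c'y.
have [bc|bc] := eqVneq b c; first by rewrite ball2_adj // -bc.
have [->|yc'] := eqVneq y c'; first exact: ball2_adj.
apply: contraNT c'N => yN; apply/imsetP; exists (c', b, y) => //.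
by rewrite inE yN !inE /= cc' c'b bc bye yc'.
Qed.

(** The k walks d, e, f, c' from d to c', one for each neighbour e of d, are
    edge-disjoint: two of them cannot share f, nor the edge of one between e and
    f be an edge of another, without creating a triangle or a 4-cycle (for e = c
    the walk is d, c, c').  Each of them contains an edge between S and its
    complement. *)
Lemma degree_le_cut (S : {set T}) c c' d :
    G c c' -> G c d -> c \in S -> c' \in S -> d \notin S ->
    ball2 c \subset ball2 c' ->
  k <= #|cut S|.
Proof.
move=> cc' cd Sc Sc' Sd sub.
have c'd : c' != d by apply: contraNneq Sd => <-.
have c'Nd : ~~ G c' d by apply: (girth5_triangle _ c) => //; rewrite adj_sym.
have mid e : G d e -> e \notin S -> exists f, G c' f && G f e.
  move=> de Se; have /(subsetP sub) : e \in ball2 c by apply: ball2_path cd de.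
  rewrite inE => /or3P[/eqP ec'|c'e|/existsP //].
    by rewrite ec' Sc' in Se.
  case/negP: Se; rewrite -(girth5_quad c' d c e) //; last by rewrite adj_sym.
  by rewrite adj_sym.
(* For the neighbours e of d outside S, the default c' is never returned. *)
pose f e := odflt c' [pick f | G c' f && G f e].
have fP e : G d e -> e \notin S -> G c' (f e) /\ G (f e) e.
  move=> de /(mid e de)[g gP]; rewrite /f; case: pickP => [h /andP[]//|/(_ g)].
  by rewrite gP.
(* The edge where the walk of e crosses the boundary of S, oriented outwards. *)
pose phi e :=
  if e \in S then (e, d) else if f e \in S then (f e, e) else (c', f e).
have phi_inj : {in nbhd d &, injective phi}.
  move=> e1 e2; rewrite !inE /phi => de1 de2.
  case: (boolP (e1 \in S)) => Se1; case: (boolP (e2 \in S)) => Se2.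
  - by case.
  - have [c'f fe] := fP _ de2 Se2; case: ifP => _ [E1 E2].
      by rewrite -E2 adj_irr in de2.
    by rewrite -E2 (negPf c'Nd) in c'f.
  - have [c'f fe] := fP _ de1 Se1; case: ifP => _ [E1 E2].
      by rewrite E2 adj_irr in de1.
    by rewrite E2 (negPf c'Nd) in c'f.
  have [c'f1 fe1] := fP _ de1 Se1; have [c'f2 fe2] := fP _ de2 Se2.
  case: ifP => _; case: ifP => _ [] //.
  - by move=> E; rewrite E adj_irr in c'f1.
  - by move=> E; rewrite -E adj_irr in c'f2.
  move=> E; rewrite -E in fe2; apply: (girth5_quad (f e1) d) => //.
    by apply: contraNneq c'Nd => <-.
  - by rewrite adj_sym.
  by rewrite adj_sym.
rewrite -(regG d : #|nbhd d| = k) -(card_in_imset phi_inj).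
apply/subset_leq_card/subsetP => w /imsetP[e]; rewrite inE => de ->.
rewrite inE /phi; case: ifPn => Se; first by rewrite adj_sym de Se.
by have [c'f fe] := fP _ de Se; case: ifPn => Sf; rewrite /= ?fe ?c'f ?Sf ?Sc'.
Qed.

Lemma escaping_empty :
  (forall x, #|escaping x| < k) -> forall x, escaping x = set0.
Proof.
move=> few x; apply/eqP/negPn/negP => /set0Pn[[[a c] d]].
rewrite inE /= => /andP[P3 xd]; move: P3.
rewrite !inE /= => /andP[/and3P[xa ac _] /andP[cd _]].
have [c' cc' eqB] := exists_nbr_ball2 _ (few c).
have xc : c \in ball2 x by apply: ball2_path xa ac.
have : k <= #|cut (ball2 x)|.
  apply: (degree_le_cut _ c c' d) => //; last by rewrite eqB.
  have : x \in ball2 c by apply: (ball2_path _ a); rewrite adj_sym.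
  by rewrite eqB ball2_sym.
rewrite leqNgt => /negP[]; exact: leq_ltn_trans (card_cut_ball2 x) (few x).
Qed.

End Girth5.
End Graph.

(** * The contradiction *)

Lemma even_card_paths3 k : ~~ odd (k * (k - 1) ^ 2).
Proof. by case: k => // k; rewrite subn1 oddM oddX /=; case: (odd k). Qed.

(* k * (k - 1) ^ 2 is even, so the division by 2 is exact, and eps <= (k - 1) / 2
   makes the subtraction of eps non-truncating. *)
Theorem theorem2p1 (k eps : nat) (hk : 3 <= k) (eps_gt0 : 0 < eps)
    (eps_le : 2 * eps <= k - 1) (n : nat) (n_gt0 : 0 < n) :
  ~ exists (T : finType) (G : sgraph T),
      vgr G n k 5 ((k * (k - 1) ^ 2) %/ 2 - eps).
Proof.
case=> T [G [cardT regG girth5 lam]].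
have even : (k * (k - 1) ^ 2) %/ 2 * 2 = k * (k - 1) ^ 2.
  by apply/eqP; rewrite -dvdn_eq dvdn2 even_card_paths3.
have big : k - 1 <= k * (k - 1) ^ 2.
  by rewrite expnS expn1 mulnCA leq_pmulr // muln_gt0; lia.
have esc x : #|escaping T G x| = 2 * eps.
  have := card_escaping _ _ girth5 _ regG x; rewrite lam; lia.
have /card_gt0P[x _] : 0 < #|T| by rewrite cardT.
have := esc x; rewrite (escaping_empty _ _ girth5 _ regG) ?cards0; first by lia.
by move=> y; rewrite esc; lia.
Qed.
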